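(* Assume $I_1\in L^1(\mu_V)$ and that $I_1,I_2$ are locally bounded. Suppose there exist $\phi\in\hat{\mathscr C}_{j,V}$ with $\phi\ge1$, $h\in C^\infty(\mathbb R^d)$ with $h>0$, and constants $b,r_0>0$ such that for all $x$, $$\hat L_{j,V}\phi(x)\le -h(x)+b\mathbf 1_{B(0,r_0)}(x).$$ If $\int\phi h^{-1}d\mu_V<\infty$ and $\kappa_r<\infty$ for every $r>1$, then there exists $C_1>0$ such that for all $f\in C_b^\infty(\mathbb R^d)$ with $\int f\,d\mu_V=0$, $$\int f^2h\phi^{-1}\,d\mu_V\le C_1D_{j,V}(f,f).$$
   Context: Let $d\ge1$; $V$ locally bounded measurable with $\int e^{-V}<\infty$, $\mu_V(dx)=e^{-V(x)}dx/\int e^{-V}$. $j\ge0$ is measurable and symmetric on $\{(x,y):x\ne y\}$. $I_1(x):=\int(1\wedge|x-y|^2)j(x,y)\mu_V(dy)$, $I_2(x):=\int_{\{|z|\le1\}}|z|\,|j(x,x+z)e^{-V(x+z)}-j(x,x-z)e^{-V(x-z)}|dz$. $D_{j,V}(f,f):=\frac12\iint(f(y)-f(x))^2j(x,y)\mu_V(dy)\mu_V(dx)$. Truncated operator: $\hat L_{j,V}f(x):=\int_{\{|x-y|>1\}}(f(y)-f(x))j(x,y)\mu_V(dy)$. $\hat{\mathscr C}_{j,V}$ is the set of $\phi\in C^\infty(\mathbb R^d)$ such that $x\mapsto\int_{\{|x-y|>1\}}|\phi(y)|j(x,y)\mu_V(dy)$ is locally bounded. $\kappa_r:=\mu_V(B(0,r))^{-2}\sup_{x\in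 B(0,r)}\int_{B(0,r)}j(x,y)^{-1}\mu_V(dy)$. *)

(* Defs.v *)
From HB Require Import structures.
From mathcomp Require Import all_boot all_order all_algebra.
From mathcomp Require Import all_classical all_reals all_analysis.
From mathcomp Require Import measurable_realfun.
Set Implicit Arguments. Unset Strict Implicit. Unset Printing Implicit Defensive.
Import Order.TTheory GRing.Theory Num.Theory.
Import numFieldNormedType.Exports.
Local Open Scope classical_set_scope.
Local Open Scope ring_scope.

Definition RdB (R : realType) (d : nat) :=
  g_sigma_algebraType (@open 'rV[R]_d).

Definition enorm (R : realType) (d : nat) (x : 'rV[R]_d) : R :=
  Num.sqrt (\sum_(i < d) x ord0 i ^+ 2).

Definition eball0 (R : realType) (d : nat) (r : R) : set 'rV[R]_d :=
  [set x | enorm x < r].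

(* lam is Lebesgue measure on the Borel sets of R^d: it gives every
   half-open box its volume (this determines it uniquely). *)
Definition is_lebesgue (R : realType) (d : nat)
  (lam : {measure set (RdB R d) -> \bar R}) : Prop :=
  forall a b : 'rV[R]_d, (forall i, a ord0 i <= b ord0 i) ->
    lam [set x : RdB R d | forall i, a ord0 i < x ord0 i <= b ord0 i] =
    (\prod_(i < d) (b ord0 i - a ord0 i))%:E.

Fixpoint iderive (R : realType) (d : nat) (vs : seq 'rV[R]_d)
  (f : 'rV[R]_d -> R) : 'rV[R]_d -> R :=
  match vs with
  | [::] => f
  | v :: vs' => fun x => derive (iderive vs' f) x v
  end.

Definition smooth (R : realType) (d : nat) (f : 'rV[R]_d -> R) : Prop :=
  forall vs : seq 'rV[R]_d,
    continuous (iderive vs f) /\ forall v x, derivable (iderive vs f) x v.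

Definition Cb_smooth (R : realType) (d : nat) (f : 'rV[R]_d -> R) : Prop :=
  smooth f /\ forall vs : seq 'rV[R]_d, exists M : R,
    forall x, `|iderive vs f x| <= M.

Definition locbdd (R : realType) (d : nat) (g : 'rV[R]_d -> R) : Prop :=
  forall x0 : 'rV[R]_d, exists e : R, 0 < e /\ exists M : R,
    forall x, enorm (x - x0) < e -> `|g x| <= M.

Definition locbdde (R : realType) (d : nat) (g : 'rV[R]_d -> \bar R) : Prop :=
  forall x0 : 'rV[R]_d, exists e : R, 0 < e /\ exists M : R,
    forall x, enorm (x - x0) < e -> (`|g x| <= M%:E)%E.

Section muV.
Local Open Scope ereal_scope.
Context (R : realType) (d : nat) (lam : {measure set (RdB R d) -> \bar R})
  (V : 'rV[R]_d -> R).

Definition ZV : \bar R := \int[lam]_x (expR (- V x))%R%:E.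

Definition densV (x : 'rV[R]_d) : R := (expR (- V x) / fine ZV)%R.

Definition intV (A : set 'rV[R]_d) (g : 'rV[R]_d -> \bar R) : \bar R :=
  \int[lam]_(x in (A : set (RdB R d))) (g x * (densV x)%:E).

Definition muV (A : set 'rV[R]_d) : \bar R := intV A (fun _ => 1).

Context (j : 'rV[R]_d -> 'rV[R]_d -> R).

Definition I1 (x : 'rV[R]_d) : \bar R :=
  intV setT (fun y => (Num.min 1 (enorm (x - y) ^+ 2) * j x y)%R%:E).

Definition I2_integrand (x z : 'rV[R]_d) : \bar R :=
  (enorm z * `| j x (x + z) * expR (- V (x + z))
                - j x (x - z) * expR (- V (x - z)) |)%R%:E.

Definition I2 (x : 'rV[R]_d) : \bar R :=
  \int[lam]_(z in ([set z | (enorm z <= 1)%R] : set (RdB R d)))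
    I2_integrand x z.

Definition Dform (f : 'rV[R]_d -> R) : \bar R :=
  (2^-1)%R%:E * intV setT (fun x =>
     intV setT (fun y => ((f y - f x) ^+ 2 * j x y)%R%:E)).

Definition Lhat (phi : 'rV[R]_d -> R) (x : 'rV[R]_d) : \bar R :=
  intV [set y | (1 < enorm (x - y))%R] (fun y => ((phi y - phi x) * j x y)%R%:E).

Definition in_Chat (phi : 'rV[R]_d -> R) : Prop :=
  smooth phi /\
  locbdde (fun x => intV [set y | (1 < enorm (x - y))%R]
                          (fun y => (`|phi y| * j x y)%R%:E)).

(* kappa_r, with j(x,y)^{-1} taken in [0,+oo] (so 0^{-1} = +oo) *)
Definition kappa (r : R) : \bar R :=
  ((fine (muV (eball0 r)))^-2)%R%:E *
  ereal_sup [set intV (eball0 r) (fun y => ((j x y)%:E)^-1) | x in eball0 r].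

End muV.

(* Main.v *)
(* A function [phi] with [L phi <= -h + b 1_B0] gives [h <= -L phi + b 1_B0].
   Multiply by [f^2 / phi] and integrate: since
   [(phi x - phi y)(f(x)^2 / phi x - f(y)^2 / phi y) <= (f x - f y)^2],
   symmetry of [j] yields, with [X] the left-hand side of the inequality,
   [X <= D(f,f) + b int_B0 f^2].  On a large ball [B], Cauchy-Schwarz with
   weights [j] and [j^-1] gives a local Poincare inequality whose constant is
   [kappa_r].  Because [int f = 0], the mean of [f] over [B] equals minus its
   integral over the complement, which Cauchy-Schwarz with weights [h / phi]
   and [phi / h] bounds by [X] times the tail of [int phi / h].  That tail is
   small for large [B], so this term is absorbed into [X], which is finite. *)

Require Import Defs.
From HB Require Import structures.
From mathcomp Require Import all_boot all_order all_algebra.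
From mathcomp Require Import all_classical all_reals all_analysis.
From mathcomp Require Import measurable_realfun.
Import Order.TTheory GRing.Theory Num.Theory.
Import numFieldNormedType.Exports.
Local Open Scope classical_set_scope.
Local Open Scope ring_scope.
From mathcomp Require Import ring lra.
Set Implicit Arguments. Unset Strict Implicit. Unset Printing Implicit Defensive.

(** Finiteness shapes the argument: the absorption is legitimate only once X is known to be finite,
    while D may be infinite. The Lyapunov estimate is therefore run with the kernel of jumps longer
    than 1. There the weight min(1, |x-y|^2) of I_1 equals 1, so integrability of I_1 gives this
    kernel finite total mass, and for bounded f the terms that have to be cancelled are finite. The
    full kernel returns twice: its energy dominates the truncated one, and the local Poincare
    inequality is about j itself, as kappa_r is. The ball must not depend on f. It is fixed by two
    conditions on mu_V, phi, h and b alone: it carries more than half of the total mass, and the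
    tail of phi / h outside it is below the total mass over 8b. Together they bound the cost of the
    mean by X / 2. All of this takes place on an abstract sigma-finite space; R^d enters through
    balls that exhaust it and through singletons being null, which makes the diagonal invisible. *)

(** * Cauchy-Schwarz from a one-parameter family of AM-GM inequalities *)

Lemma mean_bound_product (R : realType) (U A B : R) : 0 <= U -> 0 <= A -> 0 <= B ->
  (forall t, 0 < t -> U *+ 2 <= t * A + t^-1 * B) -> U ^+ 2 <= A * B.
Proof.
move=> U0 A0 B0 H.
have [->|Un0] := eqVneq U 0; first by rewrite expr0n /= mulr_ge0.
have Up : 0 < U by rewrite lt_neqAle eq_sym Un0.
have [A0'|An0] := eqVneq A 0.
  (* With [A = 0] this [t] gives [2 U <= U B / (B + 1) <= U], against [U > 0]. *)
  have := H ((B + 1) / U); rewrite A0' mulr0 add0r invf_div => /(_ _)/wrap[].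
    by rewrite divr_gt0// ltr_wpDl.
  have : U / (B + 1) * B <= U.
    by rewrite -mulrA ler_piMr// ler_pdivrMl; lra.
  lra.
have Ap : 0 < A by rewrite lt_neqAle eq_sym An0.
(* [t = U / A] turns [t A] into [U] and leaves [U <= A B / U]; the optimal [t] would need a square
   root and [B > 0]. *)
have := H (U / A) (divr_gt0 Up Ap); rewrite divfK// invf_div mulr2n lerD2l.
by rewrite mulrAC ler_pdivlMr// expr2.
Qed.

Lemma measurable_fun_posinv d (T : measurableType d) (R : realType) (g : T -> R) :
  (forall x, 0 <= g x) -> measurable_fun setT g ->
  measurable_fun setT (fun x => (g x)^-1).
Proof.
move=> g0 mg; rewrite (_ : (fun x => _) = (@powR R ^~ (-1)) \o g).
  by apply: measurableT_comp.
by apply/funext => x /=; rewrite powR_inv1.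
Qed.

Lemma emeasurable_fun_posinv d (T : measurableType d) (R : realType) (g : T -> R) :
  (forall x, 0 <= g x) -> measurable_fun setT g ->
  measurable_fun setT (fun x => ((g x)%:E^-1)%E).
Proof.
move=> g0 mg.
rewrite (_ : (fun x => _) =
  (fun x => if g x == 0 then +oo%E else ((g x)^-1)%:E)); last first.
  by apply/funext => x; rewrite inver.
apply: measurable_fun_ifT => //.
- by apply: measurable_fun_eqr.
- by apply/measurable_EFinP; exact: measurable_fun_posinv.
Qed.

(* Cauchy-Schwarz in a form that tolerates [A = 0] and [B = +oo]: with
   [U = |u| w], [A = u^2 a w] and [B = a^-1 w] it bounds [int |u| w]. *)
Lemma integral_mean_bound d (T : measurableType d) (R : realType)
  (mu : {measure set T -> \bar R}) (D : set T) (U A B : T -> \bar R) (a b : R) :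
  measurable D -> measurable_fun D U -> measurable_fun D A -> measurable_fun D B ->
  (forall x, D x -> 0 <= U x)%E -> (forall x, D x -> 0 <= A x)%E ->
  (forall x, D x -> 0 <= B x)%E ->
  (forall t x, 0 < t -> D x -> (U x + U x <= t%:E * A x + t^-1%:E * B x)%E) ->
  (\int[mu]_(x in D) A x <= a%:E)%E -> (\int[mu]_(x in D) B x <= b%:E)%E ->
  exists u : R, [/\ (\int[mu]_(x in D) U x = u%:E)%E, 0 <= u & u ^+ 2 <= a * b].
Proof.
move=> mD mU mA mB U0 A0 B0 H HA HB.
have HU t : 0 < t -> (\int[mu]_(x in D) U x + \int[mu]_(x in D) U x <=
    (t * a + t^-1 * b)%:E)%E.
  move=> t0; rewrite -ge0_integralD//.
  apply: (@le_trans _ _ (\int[mu]_(x in D) (t%:E * A x + t^-1%:E * B x))%E).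
    apply: ge0_le_integral => //.
    - by move=> x Dx; rewrite adde_ge0 ?U0.
    - exact: emeasurable_funD.
    - by apply: emeasurable_funD; exact: measurable_funeM.
    - by move=> x Dx; apply: H.
  have t0' : 0 <= t by exact: ltW.
  have tV0 : 0 <= t^-1 by rewrite invr_ge0.
  rewrite ge0_integralD//; first last.
  - exact: measurable_funeM.
  - by move=> x Dx; rewrite mule_ge0 ?lee_fin ?B0.
  - exact: measurable_funeM.
  - by move=> x Dx; rewrite mule_ge0 ?lee_fin ?A0.
  rewrite !ge0_integralZl_EFin// EFinD !EFinM.
  by apply: leeD; apply: lee_wpmul2l.
have IU0 : (0 <= \int[mu]_(x in D) U x)%E by exact: integral_ge0.
have IA0 : (0 <= \int[mu]_(x in D) A x)%E by exact: integral_ge0.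
have IB0 : (0 <= \int[mu]_(x in D) B x)%E by exact: integral_ge0.
have a0 : 0 <= a by rewrite -lee_fin (le_trans IA0).
have b0 : 0 <= b by rewrite -lee_fin (le_trans IB0).
case: (\int[mu]_(x in D) U x)%E IU0 HU => [u||] //.
- rewrite lee_fin => u0 HU; exists u; split => //.
  exact: mean_bound_product.
- by move=> _ /(_ 1 ltr01); rewrite addye.
Qed.

(** * Symmetric kernels and the Lyapunov energy estimate *)

Lemma ge0_iterated_integral d (T : measurableType d) (R : realType)
  (m : {sigma_finite_measure set T -> \bar R}) (F : T * T -> R) :
  measurable_fun setT F -> (forall z, 0 <= F z) ->
  (\int[m]_x \int[m]_y (F (x, y))%:E = \int[m \x m]_z (F z)%:E)%E.
Proof.
by move=> mF F0; rewrite fubini_tonelli1//; exact/measurable_EFinP.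
Qed.

Lemma ge0_integral_swap d (T : measurableType d) (R : realType)
  (m : {sigma_finite_measure set T -> \bar R}) (F : T * T -> R) :
  measurable_fun setT F -> (forall z, 0 <= F z) ->
  (\int[m \x m]_z (F (z.2, z.1))%:E = \int[m \x m]_z (F z)%:E)%E.
Proof.
move=> mF F0.
have mFs : measurable_fun setT (fun z : T * T => F (z.2, z.1)).
  by apply: (measurableT_comp mF); apply: measurable_fun_pair;
    [exact: measurable_snd|exact: measurable_fst].
rewrite -!ge0_iterated_integral//.
rewrite (fubini_tonelli (fun z => (F (z.2, z.1))%:E))//=.
- exact/measurable_EFinP.
- by move=> z; rewrite lee_fin.
Qed.

(** The gap is the square [(u q - v p)^2 / (p q)]. The cross terms stand on the right, so that both
    sides are nonnegative and can be integrated without any integrability condition. *)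
Lemma lyapunov_pointwise (R : realType) (u v p q : R) : 0 < p -> 0 < q ->
  u ^+ 2 + v ^+ 2 <= (v - u) ^+ 2 + (u ^+ 2 / p * q + v ^+ 2 / q * p).
Proof.
move=> p0 q0.
have -> : (v - u) ^+ 2 + (u ^+ 2 / p * q + v ^+ 2 / q * p) =
  u ^+ 2 + v ^+ 2 + (u * q - v * p) ^+ 2 / (p * q).
  by field; rewrite !gt_eqF.
by rewrite lerDl divr_ge0 ?sqr_ge0 ?mulr_ge0 ?ltW.
Qed.

(** In the application [K], [H] and [beta] already contain the density of the measure. The bound [M]
    on [f] serves only to make integrals finite and does not enter the estimate; finiteness of the
    left-hand side is a separate conclusion because the later absorption relies on it. *)
Lemma lyapunov_energy_bound d (T : measurableType d) (R : realType)
  (m : {sigma_finite_measure set T -> \bar R}) (K : T * T -> R)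
  (f phi H beta : T -> R) (M : R) :
  measurable_fun setT K -> (forall z, 0 <= K z) ->
  (forall x y, K (x, y) = K (y, x)) ->
  measurable_fun setT f -> measurable_fun setT phi ->
  measurable_fun setT H -> measurable_fun setT beta ->
  (forall x, `|f x| <= M) -> (forall x, 1 <= phi x) ->
  (forall x, 0 <= H x) -> (forall x, 0 <= beta x) ->
  (\int[m \x m]_z (K z)%:E < +oo)%E ->
  (\int[m]_x (beta x)%:E < +oo)%E ->
  (forall x, (H x)%:E + \int[m]_y (phi y * K (x, y))%:E <=
    (phi x)%:E * \int[m]_y (K (x, y))%:E + (beta x)%:E)%E ->
  (\int[m]_x (f x ^+ 2 / phi x * H x)%:E < +oo)%E /\
  (\int[m]_x (f x ^+ 2 / phi x * H x)%:E <=
    2^-1%:E * \int[m \x m]_z ((f z.2 - f z.1) ^+ 2 * K z)%:E +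
    \int[m]_x (f x ^+ 2 / phi x * beta x)%:E)%E.
Proof.
move=> mK K0 Ksym mf mphi mH mb fM phi1 H0 b0 Kfin bfin lyap.
have phi0 x : 0 < phi x by rewrite (lt_le_trans ltr01).
have phi0' x : 0 <= phi x by exact: ltW.
have mf1 : measurable_fun setT (fun z : T * T => f z.1).
  by apply: (measurableT_comp mf); exact: measurable_fst.
have mf2 : measurable_fun setT (fun z : T * T => f z.2).
  by apply: (measurableT_comp mf); exact: measurable_snd.
have mp1 : measurable_fun setT (fun z : T * T => phi z.1).
  by apply: (measurableT_comp mphi); exact: measurable_fst.
have mp2 : measurable_fun setT (fun z : T * T => phi z.2).
  by apply: (measurableT_comp mphi); exact: measurable_snd.
pose g x := f x ^+ 2 / phi x.
have g0 x : 0 <= g x by rewrite divr_ge0 ?sqr_ge0.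
have mg : measurable_fun setT g.
  by apply: measurable_funM; [exact: measurable_funX|exact: measurable_fun_posinv].
have mg1 : measurable_fun setT (fun z : T * T => g z.1).
  by apply: (measurableT_comp mg); exact: measurable_fst.
have mg2 : measurable_fun setT (fun z : T * T => g z.2).
  by apply: (measurableT_comp mg); exact: measurable_snd.
set X := (\int[m]_x (f x ^+ 2 / phi x * H x)%:E)%E.
set Y := (\int[m]_x (f x ^+ 2 / phi x * beta x)%:E)%E.
set E := (\int[m \x m]_z ((f z.2 - f z.1) ^+ 2 * K z)%:E)%E.
pose P := (\int[m \x m]_z (g z.1 * (phi z.2 * K z))%:E)%E.
pose P' := (\int[m \x m]_z (g z.2 * (phi z.1 * K z))%:E)%E.
pose Q := (\int[m \x m]_z (f z.1 ^+ 2 * K z)%:E)%E.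
pose Q' := (\int[m \x m]_z (f z.2 ^+ 2 * K z)%:E)%E.
have mP : measurable_fun setT (fun z => g z.1 * (phi z.2 * K z)).
  by apply: measurable_funM => //; exact: measurable_funM.
have mP' : measurable_fun setT (fun z => g z.2 * (phi z.1 * K z)).
  by apply: measurable_funM => //; exact: measurable_funM.
have mQ : measurable_fun setT (fun z => f z.1 ^+ 2 * K z).
  by apply: measurable_funM => //; exact: measurable_funX.
have mQ' : measurable_fun setT (fun z => f z.2 ^+ 2 * K z).
  by apply: measurable_funM => //; exact: measurable_funX.
have mE : measurable_fun setT (fun z => (f z.2 - f z.1) ^+ 2 * K z).
  by apply: measurable_funM => //; apply: measurable_funX; exact: measurable_funB.
have P0 z : 0 <= g z.1 * (phi z.2 * K z).
  exact: mulr_ge0 (g0 _) (mulr_ge0 (phi0' _) (K0 _)).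
have P'0 z : 0 <= g z.2 * (phi z.1 * K z).
  exact: mulr_ge0 (g0 _) (mulr_ge0 (phi0' _) (K0 _)).
have Q0 z : 0 <= f z.1 ^+ 2 * K z by rewrite mulr_ge0// sqr_ge0.
have Q'0 z : 0 <= f z.2 ^+ 2 * K z by rewrite mulr_ge0// sqr_ge0.
have E0 z : 0 <= (f z.2 - f z.1) ^+ 2 * K z by rewrite mulr_ge0// sqr_ge0.
have PP' : P' = P.
  rewrite /P -[RHS]ge0_integral_swap//; apply: eq_integral => -[x y] _ /=.
  by rewrite Ksym.
have QQ' : Q' = Q.
  rewrite /Q -[RHS]ge0_integral_swap//; apply: eq_integral => -[x y] _ /=.
  by rewrite Ksym.
have X0 : (0 <= X)%E.
  by apply: integral_ge0 => x _; rewrite lee_fin mulr_ge0// divr_ge0 ?sqr_ge0.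
have PI0 : (0 <= P)%E by apply: integral_ge0 => z _; rewrite lee_fin.
have E0' : (0 <= E)%E by apply: integral_ge0 => z _; rewrite lee_fin.
(* After symmetrisation [P] plays the role of
   [- int f^2 / phi * L phi] up to [Q]; all terms stay nonnegative, so no
   difference of possibly infinite integrals ever occurs. *)
have QQ : (Q + Q <= E + (P + P))%E.
  rewrite -{2}QQ' -{2}PP' -!ge0_integralD//=; first last.
  all: try by move=> *; rewrite ?adde_ge0 ?lee_fin.
  all: try by do ?apply: emeasurable_funD; exact/measurable_EFinP.
  apply: ge0_le_integral => //=.
  - by move=> z _; rewrite -EFinD lee_fin addr_ge0.
  - by apply: emeasurable_funD; exact/measurable_EFinP.
  - by do ?apply: emeasurable_funD; exact/measurable_EFinP.
  move=> z _; rewrite -!EFinD lee_fin /g !mulrA -!mulrDl.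
  exact/ler_wpM2r/lyapunov_pointwise.
(* Here [f] bounded and [K] of finite total mass are combined. *)
have QM : (Q < +oo)%E.
  apply: (@le_lt_trans _ _ ((M ^+ 2)%:E * \int[m \x m]_z (K z)%:E)%E).
    rewrite -ge0_integralZl_EFin//; first last.
    - exact: sqr_ge0.
    - exact/measurable_EFinP.
    - by move=> z _; rewrite lee_fin.
    apply: ge0_le_integral => //.
    - by move=> z _; rewrite lee_fin.
    - exact/measurable_EFinP.
    - by apply: measurable_funeM; exact/measurable_EFinP.
    - move=> z _; rewrite -EFinM lee_fin ler_wpM2r//.
      by rewrite -real_normK ?num_real// lerXn2r ?nnegrE// (le_trans _ (fM z.1)).
  by rewrite lte_mul_pinfty// ?lee_fin ?sqr_ge0.
have YM : (Y < +oo)%E.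
  apply: (@le_lt_trans _ _ ((M ^+ 2)%:E * \int[m]_z (beta z)%:E)%E).
    rewrite -ge0_integralZl_EFin//; first last.
    - exact: sqr_ge0.
    - exact/measurable_EFinP.
    - by move=> z _; rewrite lee_fin.
    apply: ge0_le_integral => //.
    - by move=> x _; rewrite lee_fin mulr_ge0// divr_ge0 ?sqr_ge0.
    - by apply/measurable_EFinP; exact: measurable_funM.
    - by apply: measurable_funeM; exact/measurable_EFinP.
    - move=> x _; rewrite -EFinM lee_fin ler_wpM2r//.
      rewrite ler_pdivrMr// (@le_trans _ _ (M ^+ 2 * 1))//; last first.
        by rewrite ler_wpM2l ?sqr_ge0.
      rewrite mulr1 -real_normK ?num_real// lerXn2r ?nnegrE//.
      by rewrite (le_trans _ (fM x)).
  by rewrite lte_mul_pinfty// ?lee_fin ?sqr_ge0.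
have mKx x : measurable_fun setT (fun y => K (x, y)).
  by apply: (measurableT_comp mK); exact: pair1_measurable.
(* The Lyapunov inequality is multiplied by [g = f^2 / phi] and integrated; [g phi = f^2] turns its
   term [phi int K] into [Q]. *)
have XP : (X + P <= Q + Y)%E.
  rewrite /P /Q -!ge0_iterated_integral//=.
  have mI (F : T * T -> R) : measurable_fun setT F -> (forall z, 0 <= F z) ->
      measurable_fun setT (fun x => \int[m]_y (F (x, y))%:E)%E.
    move=> mF F0; apply: (@measurable_fun_fubini_tonelli_F _ _ _ _ _ m
      (fun z => (F z)%:E)) => //.
    exact/measurable_EFinP.
  rewrite -!ge0_integralD//=; first last.
  all: try exact: (mI _ mP).
  all: try exact: (mI _ mQ).
  all: try by apply/measurable_EFinP; exact: measurable_funM.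
  all: try by move=> *; rewrite lee_fin mulr_ge0// divr_ge0 ?sqr_ge0.
  all: try by move=> x _; apply: integral_ge0 => y _; rewrite lee_fin ?(P0 (x, y)) ?(Q0 (x, y)).
  apply: ge0_le_integral => //=.
  - move=> x _; rewrite adde_ge0//; first by rewrite lee_fin mulr_ge0// divr_ge0 ?sqr_ge0.
    by apply: integral_ge0 => y _; rewrite lee_fin ?(P0 (x, y)).
  - apply: emeasurable_funD; last exact: (mI _ mP).
    by apply/measurable_EFinP; exact: measurable_funM.
  - apply: emeasurable_funD; first exact: (mI _ mQ).
    by apply/measurable_EFinP; exact: measurable_funM.
  move=> x _.
  have -> : (\int[m]_y (g x * (phi y * K (x, y)))%:E =
      (g x)%:E * \int[m]_y (phi y * K (x, y))%:E)%E.
    rewrite -ge0_integralZl_EFin//.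
    - by move=> y _; rewrite lee_fin mulr_ge0.
    - by apply/measurable_EFinP; exact: measurable_funM.
  have -> : (\int[m]_y (f x ^+ 2 * K (x, y))%:E =
      (g x)%:E * ((phi x)%:E * \int[m]_y (K (x, y))%:E))%E.
    rewrite muleA -EFinM divfK ?gt_eqF// -ge0_integralZl_EFin ?sqr_ge0//.
    - by move=> y _; rewrite lee_fin.
    - exact/measurable_EFinP.
  rewrite -/(g x) (EFinM (g x) (H x)) (EFinM (g x) (beta x)).
  have I0 : (0 <= \int[m]_y (K (x, y))%:E)%E.
    by apply: integral_ge0 => y _; rewrite lee_fin.
  have J0 : (0 <= \int[m]_y (phi y * K (x, y))%:E)%E.
    by apply: integral_ge0 => y _; rewrite lee_fin mulr_ge0.
  have L0 : (0 <= (phi x)%:E * \int[m]_y (K (x, y))%:E)%E.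
    by rewrite mule_ge0// lee_fin.
  rewrite -!ge0_muleDr ?lee_fin//.
  by apply: lee_wpmul2l; [rewrite lee_fin|exact: lyap].
have QY : (Q + Y < +oo)%E by rewrite lte_add_pinfty.
have Xfin : (X < +oo)%E by apply: le_lt_trans QY; apply: le_trans XP; rewrite leeDl.
split=> //.
have Pfin : (P < +oo)%E by apply: le_lt_trans QY; apply: le_trans XP; rewrite leeDr.
have Q0' : (0 <= Q)%E by apply: integral_ge0 => z _; rewrite lee_fin.
have Y0' : (0 <= Y)%E.
  by apply: integral_ge0 => x _; rewrite lee_fin mulr_ge0// divr_ge0 ?sqr_ge0.
clear PP' QQ' QY.
(* In real numbers, [2 X + 2 P <= 2 Q + 2 Y <= E + 2 P + 2 Y], and the finite [P] cancels. If [E] is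
   infinite there is nothing to prove. *)
move: XP QQ Xfin Pfin QM YM X0 PI0 Q0' Y0' E0'.
case: X => [x||]//; case: P => [p||]//; case: Q => [q||]//; case: Y => [y||]//.
case: E => [e||]//; last by rewrite mulry gtr0_sg ?mul1e// ?invr_gt0// addye ?leey.
rewrite -?EFinM -?EFinD !lee_fin => *; lra.
Qed.

(** * Local Poincare inequality for a kernel that may vanish *)

(** For positive [a] and [w] the gap is [w (t a |u| - 1)^2 / (t a)]. For [a = 0] the right-hand side
    is [+oo], unless [w = 0], where the convention [0 * +oo = 0] makes both sides vanish. It feeds
    [integral_mean_bound], with [a] the kernel [j] and then with [a = h / phi]. *)
Lemma weighted_am_gm (R : realType) (t a u w : R) : 0 < t -> 0 <= a -> 0 <= w ->
  ((`|u| * w)%:E + (`|u| * w)%:E <=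
   t%:E * (u ^+ 2 * a * w)%:E + t^-1%:E * (a%:E^-1 * w%:E))%E.
Proof.
move=> t0 a0 w0; have [->|wn0] := eqVneq w 0.
  by rewrite !mulr0 !mule0 addr0.
have wp : 0 < w by rewrite lt_neqAle eq_sym wn0.
rewrite inver; case: eqVneq => [->|an0].
  rewrite gt0_mulye ?lte_fin// gt0_muley ?lte_fin ?invr_gt0//.
  by rewrite mulr0 mul0r mule0 add0e leey.
have ap : 0 < a by rewrite lt_neqAle eq_sym an0.
rewrite -!EFinM -!EFinD lee_fin -real_normK ?num_real//; set v := `|u|.
rewrite -subr_ge0.
rewrite (_ : _ - _ = (t * a * v - 1) ^+ 2 / (t * a) * w).
  by rewrite mulr_ge0// divr_ge0 ?sqr_ge0// mulr_ge0// ltW.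
by field; rewrite !gt_eqF.
Qed.

(** For [x] in [B], [f x * mass - F] is the integral over [B] of [(f x - f y) w y], so
    Cauchy-Schwarz is needed in [y] only, with weights [j w] and [j^-1 w]. The quotient
    [S / mass ^+ 2] plays the role of kappa_r. The mean [F / mass] survives as a separate term,
    since [f] need not average to zero over [B]. *)
Lemma local_poincare d (T : measurableType d) (R : realType)
  (m : {sigma_finite_measure set T -> \bar R}) (j : T -> T -> R)
  (f w : T -> R) (B : set T) (M S mass F : R) :
  measurable_fun setT (fun z : T * T => j z.1 z.2) ->
  (forall x y, 0 <= j x y) ->
  measurable_fun setT f -> (forall x, `|f x| <= M) ->
  measurable_fun setT w -> (forall x, 0 <= w x) ->
  measurable B -> 0 < mass -> (\int[m]_(x in B) (w x)%:E = mass%:E)%E ->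
  (\int[m]_(x in B) (f x * w x)%:E = F%:E)%E ->
  0 < S ->
  (forall x, B x -> (\int[m]_(y in B) ((j x y)%:E^-1 * (w y)%:E) <= S%:E)%E) ->
  (\int[m]_(x in B) (f x ^+ 2 * w x)%:E <=
    (2 * S / mass ^+ 2)%:E *
      \int[m]_x \int[m]_y ((f y - f x) ^+ 2 * j x y * w y * w x)%:E +
    (2 * F ^+ 2 / mass)%:E)%E.
Proof.
move=> mj j0 mf fM mw w0 mB mass0 wB FB S0 jS.
have mjx x : measurable_fun setT (j x).
  by apply: (measurableT_comp mj (pair1_measurable x)).
pose A x y := (f y - f x) ^+ 2 * j x y * w y.
have A0 x y : 0 <= A x y by exact: mulr_ge0 (mulr_ge0 (sqr_ge0 _) (j0 _ _)) (w0 _).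
have mA2 : measurable_fun setT (fun z : T * T => A z.1 z.2).
  apply: measurable_funM; last first.
    by apply: (measurableT_comp mw); exact: measurable_snd.
  apply: measurable_funM => //; apply: measurable_funX; apply: measurable_funB.
    by apply: (measurableT_comp mf); exact: measurable_snd.
  by apply: (measurableT_comp mf); exact: measurable_fst.
have mA x : measurable_fun setT (A x).
  by apply: (measurableT_comp mA2 (pair1_measurable x)).
pose G x := (\int[m]_y (A x y)%:E)%E.
have G0 x : (0 <= G x)%E by apply: integral_ge0 => y _; rewrite lee_fin.
have mG : measurable_fun setT G.
  apply: (@measurable_fun_fubini_tonelli_F _ _ _ _ _ m
      (fun z => (A z.1 z.2)%:E)) => //; first exact/measurable_EFinP.
  by move=> z; rewrite lee_fin.
have iw : m.-integrable B (EFin \o w).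
  apply/integrableP; split; first by apply/measurable_EFinP; exact: measurable_funTS.
  under eq_integral do rewrite /= ger0_norm//.
  by rewrite wB ltry.
have ifw : m.-integrable B (EFin \o (fun x => f x * w x)).
  apply: (@le_integrable _ _ _ _ _ mB _ (fun x => M%:E * (EFin \o w) x)%E).
  - by apply/measurable_EFinP; apply: measurable_funTS; exact: measurable_funM.
  - move=> x _ /=; rewrite lee_fin !normrM (ger0_norm (w0 x)) ler_wpM2r//.
    by rewrite (le_trans (fM x))// ler_norm.
  - exact: integrableZl.
have key x : B x -> (((f x * mass - F) ^+ 2)%:E <= S%:E * G x)%E.
  move=> Bx.
  have [->|] := eqVneq (G x) +oo%E; first by rewrite gt0_muley ?lte_fin// leey.
  rewrite -ltey => Gfin.
  have mAB : measurable_fun B (fun y => (A x y)%:E).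
    by apply/measurable_EFinP; exact: measurable_funTS.
  have mU : measurable_fun setT (fun y => `|f y - f x| * w y).
    apply: measurable_funM => //; apply: measurableT_comp => //.
    exact: measurable_funB.
  have := @integral_mean_bound _ _ _ m B (fun y => (`|f y - f x| * w y)%:E)
    (fun y => (A x y)%:E) (fun y => (j x y)%:E^-1 * (w y)%:E)%E (fine (G x)) S mB.
  case.
  - by apply/measurable_EFinP; exact: measurable_funTS.
  - by [].
  - apply: emeasurable_funM; last by apply/measurable_EFinP; exact: measurable_funTS.
    by apply: measurable_funTS; exact: emeasurable_fun_posinv.
  - by move=> y _; rewrite lee_fin mulr_ge0.
  - by move=> y _; rewrite lee_fin.
  - by move=> y _; rewrite mule_ge0 ?inve_ge0 ?lee_fin.
  - by move=> t y t0 _; exact: weighted_am_gm.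
  - rewrite fineK ?ge0_fin_numE//; apply: ge0_subset_integral => //.
      exact/measurable_EFinP.
    by move=> y _; rewrite lee_fin.
  - exact: jS.
  move=> u [Uu u0 uS].
  rewrite -(fineK (_ : G x \is a fin_num)) ?ge0_fin_numE// -EFinM lee_fin (mulrC S).
  apply: le_trans uS.
  rewrite -real_normK ?num_real// lerXn2r ?nnegrE//.
  rewrite -lee_fin -Uu.
  have -> : ((`|f x * mass - F|)%:E =
      `| \int[m]_(y in B) ((f x * w y)%:E - (f y * w y)%:E)|)%E.
    rewrite integralB_EFin//; last first.
      by apply: (eq_integrable mB (fun y => (f x)%:E * (EFin \o w) y)%E) => //;
        exact: integrableZl.
    rewrite FB; under eq_integral do rewrite EFinM.
    by rewrite integralZl// wB.
  have md : measurable_fun B (fun y => (f x * w y)%:E - (f y * w y)%:E)%E.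
    apply: emeasurable_funB; (apply/measurable_EFinP; apply: measurable_funTS).
      exact: measurable_funM.
    exact: measurable_funM.
  apply: (le_trans (le_abse_integral m mB md)).
  apply: ge0_le_integral => //.
  - exact: measurableT_comp.
  - by apply/measurable_EFinP; exact: measurable_funTS.
  - move=> y _; rewrite -EFinB abse_EFin lee_fin -mulrBl normrM distrC.
    by rewrite (ger0_norm (w0 y)).
pose c1 : R := 2 * S / mass ^+ 2; pose c2 : R := 2 * F ^+ 2 / mass ^+ 2.
have c10 : 0 <= c1 by rewrite divr_ge0 ?sqr_ge0// mulr_ge0// ltW.
have c20 : 0 <= c2 by rewrite divr_ge0 ?sqr_ge0// mulr_ge0 ?sqr_ge0.
have mGw : measurable_fun setT (fun x => G x * (w x)%:E)%E.
  by apply: emeasurable_funM => //; exact/measurable_EFinP.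
have Gw0 x : (0 <= G x * (w x)%:E)%E by rewrite mule_ge0 ?lee_fin.
apply: (@le_trans _ _ (\int[m]_(x in B)
    (c1%:E * (G x * (w x)%:E) + c2%:E * (w x)%:E))%E).
  apply: ge0_le_integral => //.
  - by move=> x _; rewrite lee_fin mulr_ge0 ?sqr_ge0.
  - apply/measurable_EFinP; apply: measurable_funTS; apply: measurable_funM => //.
    exact: measurable_funX.
  - apply: emeasurable_funD; apply: measurable_funeM; apply: measurable_funTS => //.
    exact/measurable_EFinP.
  move=> x Bx; have kx := key x Bx.
  rewrite muleA -ge0_muleDl ?mule_ge0 ?lee_fin// (EFinM (f x ^+ 2)).
  apply: lee_wpmul2r; rewrite ?lee_fin//.
  (* With [c = F / mass] this is [f^2 <= 2 (f - c)^2 + 2 c^2], whose gap is [(f - 2 c)^2]. *)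
  apply: (@le_trans _ _ ((2 / mass ^+ 2)%:E * ((f x * mass - F) ^+ 2)%:E + c2%:E)%E).
    rewrite -EFinM -EFinD lee_fin /c2 -subr_ge0.
    rewrite (_ : _ - _ = (f x - 2 * F / mass) ^+ 2) ?sqr_ge0//.
    by field; rewrite gt_eqF.
  apply: leeD => //.
  rewrite (_ : c1 = 2 / mass ^+ 2 * S); last by rewrite /c1; ring.
  rewrite [in leRHS]EFinM -muleA; apply: lee_wpmul2l => //.
  by rewrite lee_fin divr_ge0 ?sqr_ge0.
rewrite ge0_integralD//; first last.
- by apply: measurable_funeM; apply/measurable_EFinP; exact: measurable_funTS.
- by move=> x _; rewrite mule_ge0 ?lee_fin.
- by apply: measurable_funeM; exact: measurable_funTS.
- by move=> x _; rewrite mule_ge0 ?lee_fin.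
rewrite !ge0_integralZl_EFin//; first last.
- exact: measurable_funTS.
- by apply/measurable_EFinP; exact: measurable_funTS.
- by move=> x _; rewrite lee_fin.
apply: leeD; last first.
  rewrite wB -EFinM lee_fin (_ : c2 * mass = 2 * F ^+ 2 / mass)// /c2.
  by field; rewrite gt_eqF.
apply: lee_wpmul2l; first by rewrite lee_fin.
apply: (@le_trans _ _ (\int[m]_x (G x * (w x)%:E))%E).
  exact: ge0_subset_integral.
rewrite le_eqVlt; apply/orP; left; apply/eqP; apply: eq_integral => x _.
rewrite muleC -ge0_integralZl_EFin//; last 2 first.
- by move=> y _; rewrite lee_fin.
- exact/measurable_EFinP.
by apply: eq_integral => y _; rewrite -EFinM mulrC.
Qed.

(** * Weighted Poincare inequality on an abstract measure space *)

(** Monotone convergence along [B n], for [w] and [g] at once; the tail of [g] is its finite total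
    minus its integral over [B n]. *)
Lemma exists_set_mass_tail d (T : measurableType d) (R : realType)
  (m : {measure set T -> \bar R}) (w g : T -> R) (B : nat -> set T) (W e : R) :
  measurable_fun setT w -> (forall x, 0 <= w x) ->
  measurable_fun setT g -> (forall x, 0 <= g x) ->
  (\int[m]_x (w x)%:E = W%:E)%E -> (\int[m]_x (g x)%:E < +oo)%E ->
  (forall n, measurable (B n)) -> {homo B : n k / (n <= k)%N >-> n `<=` k} ->
  \bigcup_n B n = setT -> 0 < W -> 0 < e ->
  exists N, exists mass eps : R, [/\ (\int[m]_(x in B N) (w x)%:E = mass%:E)%E,
    W / 2 < mass, (\int[m]_(x in ~` B N) (g x)%:E = eps%:E)%E & eps < e].
Proof.
move=> mw w0 mg g0 wW gfin mB ndB BT W0 e0.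
have homB : {homo B : n k / (n <= k)%N >-> (n <= k)%O}.
  by move=> n k nk; apply/subsetPset; exact: ndB.
have mfin (u : T -> R) n : measurable_fun setT u ->
    measurable_fun (B n) (fun x => (u x)%:E).
  by move=> mu; apply/measurable_EFinP; exact: measurable_funTS.
have cw := @ge0_nondecreasing_set_cvg_integral _ _ _ B (fun x => (w x)%:E) m
  homB mB (fun n => mfin w n mw) (fun n x _ => w0 x).
have cg := @ge0_nondecreasing_set_cvg_integral _ _ _ B (fun x => (g x)%:E) m
  homB mB (fun n => mfin g n mg) (fun n x _ => g0 x).
rewrite BT wW in cw; rewrite BT in cg.
have I0 (u : T -> R) (D : set T) : (forall x, 0 <= u x) ->
    (0 <= \int[m]_(x in D) (u x)%:E)%E.
  by move=> u0; apply: integral_ge0 => x _; rewrite lee_fin.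
have sub (u : T -> R) (D : set T) : measurable D -> measurable_fun setT u ->
    (forall x, 0 <= u x) ->
    (\int[m]_(x in D) (u x)%:E <= \int[m]_x (u x)%:E)%E.
  move=> mD mu u0; apply: ge0_subset_integral => //; first exact/measurable_EFinP.
  by move=> x _; rewrite lee_fin.
have /fineK gE : (\int[m]_x (g x)%:E)%E \is a fin_num by rewrite ge0_fin_numE ?I0.
set tot := fine (\int[m]_x (g x)%:E)%E in gE.
rewrite -gE in cg.
have nw : \forall n \near \oo, ((W / 2)%:E < \int[m]_(x in B n) (w x)%:E)%E.
  apply: (cw (fun y => (W / 2)%:E < y)%E).
  by apply: open_nbhs_nbhs; split; [exact: open_ereal_gt_ereal|rewrite /= lte_fin; lra].
have ng : \forall n \near \oo, ((tot - e)%:E < \int[m]_(x in B n) (g x)%:E)%E.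
  apply: (cg (fun y => (tot - e)%:E < y)%E).
  by apply: open_nbhs_nbhs; split; [exact: open_ereal_gt_ereal|rewrite /= lte_fin; lra].
have [N _ NP] := filterI nw ng.
exists N; have [H1 H2] := NP N (leqnn N).
have f1 : (\int[m]_(x in B N) (w x)%:E)%E \is a fin_num.
  by rewrite ge0_fin_numE ?I0// (le_lt_trans (sub w _ (mB N) mw w0))// wW ltry.
have f2 : (\int[m]_(x in B N) (g x)%:E)%E \is a fin_num.
  by rewrite ge0_fin_numE ?I0// (le_lt_trans (sub g _ (mB N) mg g0))// -gE ltry.
have mC : measurable (~` B N) by exact: measurableC.
have f3 : (\int[m]_(x in ~` B N) (g x)%:E)%E \is a fin_num.
  by rewrite ge0_fin_numE ?I0// (le_lt_trans (sub g _ mC mg g0))// -gE ltry.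
exists (fine (\int[m]_(x in B N) (w x)%:E)), (fine (\int[m]_(x in ~` B N) (g x)%:E)).
rewrite !fineK//; split => //; first by rewrite -lte_fin fineK.
have := gE; rewrite -{1}(setUv (B N)) ge0_integral_setU//; first last.
- exact/disj_setPCl.
- by move=> x _; rewrite lee_fin.
- by rewrite setUv; exact/measurable_EFinP.
move: H2; rewrite -(fineK f2) -(fineK f3) -EFinD lte_fin => H2 [].
rewrite !fineK// => E; move: H2; rewrite E; lra.
Qed.


(** Two kernels occur: [K] carries the Lyapunov condition and has finite mass, while the larger [j]
    carries the local Poincare inequality and the energy in the conclusion. [C] is chosen before [f]
    and does not depend on [M]. *)
Lemma lyapunov_weighted_poincare d (T : measurableType d) (R : realType)
  (m : {sigma_finite_measure set T -> \bar R}) (j K : T -> T -> R)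
  (w phi h : T -> R) (B0 : set T) (B : nat -> set T) (W b : R) :
  measurable_fun setT (fun z : T * T => j z.1 z.2) ->
  measurable_fun setT (fun z : T * T => K z.1 z.2) ->
  (forall x y, 0 <= K x y) -> (forall x y, K x y <= j x y) ->
  (forall x y, K x y = K y x) ->
  measurable_fun setT w -> (forall x, 0 <= w x) ->
  (\int[m]_x (w x)%:E = W%:E)%E -> 0 < W ->
  measurable_fun setT phi -> (forall x, 1 <= phi x) ->
  measurable_fun setT h -> (forall x, 0 < h x) ->
  measurable B0 -> 0 < b ->
  (\int[m]_x \int[m]_y (K x y * w y * w x)%:E < +oo)%E ->
  (forall x, (h x)%:E + \int[m]_y (phi y * (K x y * w y))%:E <=
    (phi x)%:E * \int[m]_y (K x y * w y)%:E + (b * \1_B0 x)%:E)%E ->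
  (\int[m]_x (phi x / h x * w x)%:E < +oo)%E ->
  (forall n, measurable (B n)) -> {homo B : n k / (n <= k)%N >-> n `<=` k} ->
  \bigcup_n B n = setT -> (forall n, B0 `<=` B n) ->
  (forall n, exists2 S : R, 0 < S & forall x, B n x ->
    (\int[m]_(y in B n) ((j x y)%:E^-1 * (w y)%:E) <= S%:E)%E) ->
  exists2 C : R, 0 < C & forall (f : T -> R) (M : R),
    measurable_fun setT f -> (forall x, `|f x| <= M) ->
    (\int[m]_x (f x * w x)%:E = 0)%E ->
    (\int[m]_x (f x ^+ 2 * h x / phi x * w x)%:E <=
      C%:E * (2^-1%:E *
        \int[m]_x \int[m]_y ((f y - f x) ^+ 2 * j x y * w y * w x)%:E))%E.
Proof.
move=> mj mK K0 Kj Ksym mw w0 wW W0 mphi phi1 mh h0 mB0 b0 Kfin lyap tailfin.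
move=> mB ndB BT B0B jS.
have phi0 x : 0 < phi x by rewrite (lt_le_trans ltr01).
have j0 x y : 0 <= j x y by exact: le_trans (K0 x y) (Kj x y).
have mtail : measurable_fun setT (fun x => phi x / h x * w x).
  apply: measurable_funM => //; apply: measurable_funM => //.
  by apply: measurable_fun_posinv => // x; exact: ltW.
have tail0 x : 0 <= phi x / h x * w x by rewrite mulr_ge0// divr_ge0 ?ltW.
(* With [F^2 <= X eps], [eps < W / (8 b)] and [mass > W / 2], the mean term [2 b F^2 / mass] is at
   most [X / 2]. *)
have e0 : 0 < W / (8 * b) by rewrite divr_gt0 ?mulr_gt0.
have [N [mass [eps [massE Wm epsE epsW]]]] :=
  exists_set_mass_tail mw w0 mtail tail0 wW tailfin mB ndB BT W0 e0.
have [S S0 HS] := jS N.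
have mass0 : 0 < mass by lra.
have c0 : 0 < 4 * b * S / mass ^+ 2 by rewrite divr_gt0 ?exprn_gt0 ?mulr_gt0.
(* The energy terms sum to [(1 + 4 b S / mass^2)] times [E / 2]; the outer factor 2 pays for
   absorbing [X / 2]. *)
exists (2 * (1 + 4 * b * S / mass ^+ 2)); first by rewrite mulr_gt0// addr_gt0.
move=> f M mf fM f0.

have mwE D : measurable_fun D (fun x => (w x)%:E).
  by apply/measurable_EFinP; exact: measurable_funTS.
have mfw : measurable_fun setT (fun x => f x * w x) by exact: measurable_funM.
pose E := (\int[m]_x \int[m]_y ((f y - f x) ^+ 2 * j x y * w y * w x)%:E)%E.
rewrite -/E.
pose K' (z : T * T) := K z.1 z.2 * w z.2 * w z.1.
have mw1 : measurable_fun setT (fun z : T * T => w z.1).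
  by apply: (measurableT_comp mw); exact: measurable_fst.
have mw2 : measurable_fun setT (fun z : T * T => w z.2).
  by apply: (measurableT_comp mw); exact: measurable_snd.
have mf1 : measurable_fun setT (fun z : T * T => f z.1).
  by apply: (measurableT_comp mf); exact: measurable_fst.
have mf2 : measurable_fun setT (fun z : T * T => f z.2).
  by apply: (measurableT_comp mf); exact: measurable_snd.
have mK' : measurable_fun setT K'.
  by apply: measurable_funM => //; exact: measurable_funM.
have K'0 z : 0 <= K' z by exact: mulr_ge0 (mulr_ge0 (K0 _ _) (w0 _)) (w0 _).
have mKx x : measurable_fun setT (fun y => K x y * w y).
  by apply: measurable_funM => //; exact: (measurableT_comp mK (pair1_measurable x)).
have Kw0 x y : 0 <= K x y * w y by exact: mulr_ge0.
have [] := @lyapunov_energy_bound _ _ _ m K' f phi (fun x => h x * w x)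
    (fun x => b * \1_B0 x * w x) M mK' K'0 _ mf mphi _ _ fM phi1 _ _ _ _ _.
- by move=> x y; rewrite /K' /= Ksym -!mulrA; congr (_ * _); rewrite mulrC.
- exact: measurable_funM.
- by apply: measurable_funM => //; apply: measurable_funM.
- by move=> x; rewrite mulr_ge0// ltW.
- by move=> x; rewrite !mulr_ge0// ltW.
- by rewrite -ge0_iterated_integral.
- apply: (@le_lt_trans _ _ (\int[m]_x (b%:E * (w x)%:E))%E).
    apply: ge0_le_integral => //.
    + by move=> x _; rewrite lee_fin !mulr_ge0// ltW.
    + apply/measurable_EFinP; apply: measurable_funM => //; exact: measurable_funM.
    + exact: measurable_funeM.
    + move=> x _; rewrite -EFinM lee_fin ler_wpM2r// ler_piMr ?(ltW b0)//.
  rewrite ge0_integralZl_EFin ?(ltW b0)//; last by move=> x _; rewrite lee_fin.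
  by rewrite wW -EFinM ltry.
- move=> x; rewrite /K' /=.
  have -> : (\int[m]_y (phi y * (K x y * w y * w x))%:E =
      (w x)%:E * \int[m]_y (phi y * (K x y * w y))%:E)%E.
    rewrite -ge0_integralZl_EFin//.
    + by apply: eq_integral => y _; rewrite -EFinM; congr EFin; ring.
    + by move=> y _; rewrite lee_fin mulr_ge0// ltW.
    + by apply/measurable_EFinP; exact: measurable_funM.
  have -> : (\int[m]_y (K x y * w y * w x)%:E =
      (w x)%:E * \int[m]_y (K x y * w y)%:E)%E.
    rewrite -ge0_integralZl_EFin//.
    + by apply: eq_integral => y _; rewrite -EFinM; congr EFin; ring.
    + by move=> y _; rewrite lee_fin.
    + exact/measurable_EFinP.
  rewrite (mulrC (h x)) (mulrC (b * _)) (EFinM (w x) (h x)) (EFinM (w x) (b * _)).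
  rewrite muleCA -!ge0_muleDr ?lee_fin ?(ltW (h0 x))//.
  + by apply: lee_wpmul2l; rewrite ?lee_fin.
  + by rewrite mule_ge0 ?lee_fin ?(ltW (phi0 x))//; apply: integral_ge0 => y _; rewrite lee_fin.
  + by rewrite mulr_ge0// ltW.
  + by apply: integral_ge0 => y _; rewrite lee_fin mulr_ge0// ltW.
have -> : (\int[m]_x (f x ^+ 2 / phi x * (h x * w x))%:E =
    \int[m]_x (f x ^+ 2 * h x / phi x * w x)%:E)%E.
  by apply: eq_integral => x _; congr EFin; ring.
set X := (\int[m]_x (f x ^+ 2 * h x / phi x * w x)%:E)%E.
set Y := (\int[m]_x (f x ^+ 2 / phi x * (b * \1_B0 x * w x))%:E)%E.
set EK := (\int[m \x m]_z _)%E.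
move=> Xfin XY.
have X0 : (0 <= X)%E.
  apply: integral_ge0 => x _; rewrite lee_fin mulr_ge0// divr_ge0//.
    by rewrite mulr_ge0 ?sqr_ge0// ltW.
  exact: ltW.
have EKE : (EK <= E)%E.
  have mj' : measurable_fun setT
      (fun z : T * T => (f z.2 - f z.1) ^+ 2 * j z.1 z.2 * w z.2 * w z.1).
    apply: measurable_funM => //; apply: measurable_funM => //.
    apply: measurable_funM => //; apply: measurable_funX; exact: measurable_funB.
  have -> : E = (\int[m \x m]_z
      ((f z.2 - f z.1) ^+ 2 * j z.1 z.2 * w z.2 * w z.1)%:E)%E.
    rewrite -ge0_iterated_integral//= => z.
    exact: mulr_ge0 (mulr_ge0 (mulr_ge0 (sqr_ge0 _) (j0 _ _)) (w0 _)) (w0 _).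
  apply: ge0_le_integral => //.
  - by move=> z _; rewrite lee_fin mulr_ge0 ?sqr_ge0.
  - apply/measurable_EFinP; apply: measurable_funM => //.
    by apply: measurable_funX; exact: measurable_funB.
  - exact/measurable_EFinP.
  - move=> z _; rewrite lee_fin /K' !mulrA.
    apply: ler_wpM2r => //; apply: ler_wpM2r => //.
    by apply: ler_wpM2l (Kj _ _); exact: sqr_ge0.
have E0 : (0 <= E)%E.
  apply: integral_ge0 => x _; apply: integral_ge0 => y _; rewrite lee_fin.
  exact: mulr_ge0 (mulr_ge0 (mulr_ge0 (sqr_ge0 _) (j0 _ _)) (w0 _)) (w0 _).
have ifw : m.-integrable setT (EFin \o (fun x => f x * w x)).
  apply: (@le_integrable _ _ _ _ _ measurableT _ (fun x => M%:E * (EFin \o w) x)%E).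
  - exact/measurable_EFinP.
  - move=> x _ /=; rewrite lee_fin !normrM (ger0_norm (w0 x)) ler_wpM2r//.
    by rewrite (le_trans (fM x))// ler_norm.
  - apply: integrableZl => //; apply/integrableP; split; first exact/measurable_EFinP.
    under eq_integral do rewrite /= ger0_norm//.
    by rewrite wW ltry.
have ifB : m.-integrable (B N) (EFin \o (fun x => f x * w x)).
  exact: integrableS ifw.
have /fineK := integrable_fin_num (mB N) ifB.
set F := fine _ => FB.
(* [phi >= 1] removes the division, and [B0] lies inside [B N]. *)
have YB : (Y <= b%:E * \int[m]_(x in B N) (f x ^+ 2 * w x)%:E)%E.
  have mfw2 D : measurable_fun D (fun x => (f x ^+ 2 * w x)%:E).
    apply/measurable_EFinP; apply: measurable_funTS; apply: measurable_funM => //.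
    exact: measurable_funX.
  rewrite -ge0_integralZl_EFin ?(ltW b0)//; last first.
    by move=> x _; rewrite lee_fin mulr_ge0 ?sqr_ge0.
  rewrite [leRHS]integral_mkcond; apply: ge0_le_integral => //.
  - move=> x _; rewrite lee_fin mulr_ge0 ?divr_ge0 ?sqr_ge0 ?(ltW (phi0 x))//.
    by rewrite !mulr_ge0// ltW.
  - apply/measurable_EFinP; apply: measurable_funM.
      apply: measurable_funM; first exact: measurable_funX.
      by apply: measurable_fun_posinv => // x; exact: ltW.
    by apply: measurable_funM => //; exact: measurable_funM.
  - apply/(measurable_restrict _ (mB N) measurableT); rewrite setTI.
    exact: measurable_funeM.
  - move=> x _; rewrite patchE; case: ifPn => [xB|xB].
      rewrite -EFinM lee_fin mulrA [leRHS]mulrA; apply: ler_wpM2r => //.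
      rewrite mulrC; apply: ler_pM => //.
      + by rewrite mulr_ge0// ltW.
      + by rewrite divr_ge0 ?sqr_ge0// ltW.
      + by rewrite ler_piMr ?(ltW b0).
      + by rewrite ler_pdivrMr// ler_peMr ?sqr_ge0.
    rewrite indicE (_ : x \in B0 = false) ?mulr0 ?mul0r ?mulr0//.
    by apply/negbTE/negP => /set_mem/(B0B N)/mem_set; exact/negP.
have LP := @local_poincare _ _ _ m j f w (B N) M S mass F mj j0 mf fM mw w0
  (mB N) mass0 massE (esym FB) S0 HS.
have FX : F ^+ 2 <= fine X * eps.
  have mC : measurable (~` B N) by exact: measurableC.
  have [] := @integral_mean_bound _ _ _ m (~` B N) (fun x => (`|f x| * w x)%:E)
    (fun x => (f x ^+ 2 * h x / phi x * w x)%:E)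
    (fun x => (phi x / h x * w x)%:E) (fine X) eps mC.
  - apply/measurable_EFinP; apply: measurable_funTS; apply: measurable_funM => //.
    exact: measurableT_comp.
  - apply/measurable_EFinP; apply: measurable_funTS; apply: measurable_funM => //.
    apply: measurable_funM; last by apply: measurable_fun_posinv => // x; exact: ltW.
    by apply: measurable_funM => //; exact: measurable_funX.
  - by apply/measurable_EFinP; exact: measurable_funTS.
  - by move=> x _; rewrite lee_fin mulr_ge0.
  - move=> x _; rewrite lee_fin mulr_ge0// divr_ge0 ?(ltW (phi0 x))//.
    by rewrite mulr_ge0 ?sqr_ge0// ltW.
  - by move=> x _; rewrite lee_fin.
  - move=> t x t0 _.
    have := @weighted_am_gm _ t (h x / phi x) (f x) (w x) t0 _ (w0 x).
    rewrite inver mulf_eq0 invr_eq0 !gt_eqF//= invf_div -EFinM mulrA.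
    by apply; rewrite divr_ge0// ltW.
  - rewrite fineK ?ge0_fin_numE//; apply: ge0_subset_integral => //.
      apply/measurable_EFinP; apply: measurable_funM => //.
      apply: measurable_funM; last by apply: measurable_fun_posinv => // x; exact: ltW.
      by apply: measurable_funM => //; exact: measurable_funX.
    move=> x _; rewrite lee_fin mulr_ge0// divr_ge0 ?(ltW (phi0 x))//.
    by rewrite mulr_ge0 ?sqr_ge0// ltW.
  - by rewrite epsE.
  move=> u [Uu u0]; apply: le_trans.
  rewrite -real_normK ?num_real// lerXn2r ?nnegrE// -lee_fin -Uu.
  have ifC : m.-integrable (~` B N) (EFin \o (fun x => f x * w x)).
    exact: integrableS ifw.
  have /fineK := integrable_fin_num mC ifC; set F' := fine _ => FC.
  have : (F%:E + F'%:E = 0)%E.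
    rewrite FB FC -f0 -[in RHS](setUv (B N)) integral_setU//.
      by rewrite setUv; exact/measurable_EFinP.
    exact/disj_setPCl.
  rewrite -EFinD => -[] /eqP; rewrite addr_eq0 => /eqP ->.
  rewrite normrN -abse_EFin FC; apply: le_trans.
    by apply: le_abse_integral => //; apply/measurable_EFinP; exact: measurable_funTS.
  rewrite le_eqVlt; apply/orP; left; apply/eqP; apply: eq_integral => x _ /=.
  by rewrite normrM (ger0_norm (w0 x)).
have eps0 : 0 <= eps.
  by rewrite -lee_fin -epsE; apply: integral_ge0 => x _; rewrite lee_fin.
move: XY; rewrite -(fineK (_ : X \is a fin_num)) ?ge0_fin_numE//.
have x0 : 0 <= fine X by exact: fine_ge0.
set x := fine X in FX x0 *.
move=> XY; have {XY YB LP} : (x%:E <= 2^-1%:E * E + b%:E *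
    ((2 * S / mass ^+ 2)%:E * E + (2 * F ^+ 2 / mass)%:E))%E.
  apply: (le_trans XY); apply: leeD.
    by apply: lee_wpmul2l => //; rewrite lee_fin invr_ge0.
  by apply: (le_trans YB); apply: lee_wpmul2l => //; rewrite lee_fin ltW.
(* An infinite energy makes the claim trivial because [C > 0]; otherwise only real numbers
   remain. *)
clear EKE; case: E E0 => [e||]// E0 XE; last first.
  by rewrite !gt0_muley ?lte_fin ?invr_gt0 ?mulr_gt0 ?addr_gt0 ?leey.
move: XE; rewrite -!(EFinM, EFinD) !lee_fin => XE.
have F2 : b * (2 * F ^+ 2 / mass) <= x / 2.
  rewrite mulrA ler_pdivrMr//.
  have : b * (2 * F ^+ 2) <= b * (2 * (x * (W / (8 * b)))).
    rewrite ler_pM2l// ler_pM2l//; apply: (le_trans FX); apply: ler_wpM2l => //.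
    exact: ltW.
  have -> : b * (2 * (x * (W / (8 * b)))) = x * (W / 4).
    by field; rewrite gt_eqF.
  move=> H; apply: (le_trans H).
  have : x * (W / 4) <= x * (mass / 2) by apply: ler_wpM2l => //; lra.
  lra.
have -> : 2 * (1 + 4 * b * S / mass ^+ 2) * (2^-1 * e) =
    2 * (2^-1 * e + b * (2 * S / mass ^+ 2 * e)).
  by field; rewrite gt_eqF.
move: XE; rewrite mulrDr; lra.
Qed.

(** * Borel sets and Lebesgue measure on R^d *)

(** Tonelli is applied to bundled sigma-finite measures, whereas [lam] is a bare measure; the
    equality moves integrals between the two. *)
Lemma sigma_finite_measure_exists d (T : measurableType d) (R : realType)
  (mu : {measure set T -> \bar R}) : sigma_finite setT mu ->
  exists m : {sigma_finite_measure set T -> \bar R}, m = mu :> (set T -> \bar R).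
Proof.
move=> sf.
pose sfin := isSFinite.Build d T R mu (sfinite_measure_sigma_finite sf).
pose sigfin := isSigmaFinite.Build d T R mu sf.
pose m : {sigma_finite_measure set T -> \bar R} :=
  HB.pack_for (SigmaFiniteMeasure.type T R) (Measure.sort mu) sfin sigfin.
by exists m.
Qed.

Lemma continuous_measurable_RdB (R : realType) (d : nat) (g : 'rV[R]_d -> R) :
  continuous g -> measurable_fun (setT : set (RdB R d)) (g : RdB R d -> R).
Proof.
move=> cg; apply: (measurability _ (@RGenOpens.measurableE R)).
move=> _ [_ [a [b ->]] <-]; rewrite setTI; apply: sub_sigma_algebra.
by apply: open_comp => // *; exact: cg.
Qed.

Lemma measurable_coord (R : realType) (d : nat) (i : 'I_d) :
  measurable_fun (setT : set (RdB R d)) (fun x : RdB R d => (x : 'rV[R]_d) ord0 i).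
Proof. by apply: continuous_measurable_RdB; exact: coord_continuous. Qed.

(** Squaring removes the root of [enorm]: this is a polynomial in the coordinates, and conditions on
    distances become conditions on it. *)
Definition sqdist (R : realType) (d : nat) (x y : 'rV[R]_d) : R :=
  \sum_(i < d) (x - y) ord0 i ^+ 2.

(** The domain carries the product of two Borel sigma-algebras, so measurability is obtained
    coordinate by coordinate rather than from joint continuity. *)
Lemma measurable_sqdist (R : realType) (d : nat) :
  measurable_fun (setT : set (RdB R d * RdB R d)) (fun z => sqdist z.1 z.2).
Proof.
apply: measurable_sum => i; apply: measurable_funX.
rewrite (_ : (fun z => _) = (fun z : RdB R d * RdB R d =>
    (z.1 : 'rV[R]_d) ord0 i - (z.2 : 'rV[R]_d) ord0 i)); last first.
  by apply/funext => z; rewrite !mxE.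
apply: measurable_funB.
  by apply: (measurableT_comp (measurable_coord i)); exact: measurable_fst.
by apply: (measurableT_comp (measurable_coord i)); exact: measurable_snd.
Qed.

Lemma measurable_sqdistr (R : realType) (d : nat) (x : 'rV[R]_d) :
  measurable_fun (setT : set (RdB R d)) (fun y : RdB R d => sqdist x y).
Proof.
have mp := @pair1_measurable _ _ (RdB R d) (RdB R d) (x : RdB R d).
exact: (measurableT_comp (@measurable_sqdist R d) mp).
Qed.

Lemma sqdist_ge0 (R : realType) (d : nat) (x y : 'rV[R]_d) : 0 <= sqdist x y.
Proof. by apply: sumr_ge0 => i _; exact: sqr_ge0. Qed.

Lemma sqdistC (R : realType) (d : nat) (x y : 'rV[R]_d) : sqdist x y = sqdist y x.
Proof. by apply: eq_bigr => i _; rewrite -opprB mxE sqrrN. Qed.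

Lemma sqdist_eq0 (R : realType) (d : nat) (x y : 'rV[R]_d) :
  (sqdist x y == 0) = (x == y).
Proof.
apply/eqP/eqP => [xy|->]; last first.
  by apply: big1 => i _; rewrite subrr mxE expr0n.
apply/eqP; rewrite -subr_eq0; apply/eqP/rowP => i.
move/eqP: xy; rewrite psumr_eq0; last by move=> k _; exact: sqr_ge0.
by move/allP/(_ i (mem_index_enum _)); rewrite sqrf_eq0 [RHS]mxE => /eqP.
Qed.

Lemma enorm_ge0 (R : realType) (d : nat) (x : 'rV[R]_d) : 0 <= enorm x.
Proof. exact: sqrtr_ge0. Qed.

Lemma enorm_sqr (R : realType) (d : nat) (x y : 'rV[R]_d) :
  enorm (x - y) ^+ 2 = sqdist x y.
Proof. by rewrite sqr_sqrtr// sqdist_ge0. Qed.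

Lemma enorm_gt1 (R : realType) (d : nat) (x y : 'rV[R]_d) :
  (1 < enorm (x - y)) = (1 < sqdist x y).
Proof.
by rewrite -enorm_sqr -[X in _ = (X < _)](expr1n _ 2) ltr_pXn2r// ?nnegrE ?enorm_ge0.
Qed.

Lemma enorm_lt (R : realType) (d : nat) (x : 'rV[R]_d) (r : R) : 0 <= r ->
  (enorm x < r) = (sqdist x 0 < r ^+ 2).
Proof. by move=> r0; rewrite -enorm_sqr subr0 ltr_pXn2r// ?nnegrE ?enorm_ge0. Qed.

Lemma measurable_eball0 (R : realType) (d : nat) (r : R) :
  measurable (eball0 r : set (RdB R d)).
Proof.
have [r0|r0] := leP 0 r; last first.
  rewrite (_ : eball0 r = set0)// -subset0 => x /=; rewrite /eball0 /=.
  by apply/negP; rewrite -leNgt (le_trans (ltW r0))// enorm_ge0.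
have ms := @measurable_sqdistr R d 0.
rewrite (_ : eball0 r = (fun x => sqdist 0 x) @^-1` `]-oo, r ^+ 2[%classic).
  by rewrite -[_ @^-1` _]setTI; exact: ms.
by apply/seteqP; split => x; rewrite /eball0 /= in_itv/= enorm_lt// sqdistC.
Qed.

Definition obox (R : realType) (d : nat) (a b : 'rV[R]_d) : set (RdB R d) :=
  [set x : RdB R d | forall i, a ord0 i < x ord0 i <= b ord0 i].

Lemma measurable_obox (R : realType) (d : nat) (a b : 'rV[R]_d) :
  measurable (obox a b).
Proof.
rewrite (_ : obox a b = \bigcap_(i in [set: 'I_d])
    ((fun x : RdB R d => (x : 'rV[R]_d) ord0 i) @^-1`
      `]a ord0 i, b ord0 i]%classic)).
  apply: fin_bigcap_measurable => // i _.
  by rewrite -[_ @^-1` _]setTI; exact: measurable_coord.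
apply/seteqP; split=> [x xab i _|x xab i]; first by rewrite /= in_itv/= xab.
by have := xab i I; rewrite /= in_itv.
Qed.

Lemma lebesgue_sigma_finite (R : realType) (d : nat)
  (lam : {measure set (RdB R d) -> \bar R}) :
  is_lebesgue lam -> sigma_finite setT lam.
Proof.
move=> lamL.
exists (fun n : nat => obox (const_mx (- n%:R)) (const_mx n%:R)).
  apply/esym; rewrite -subTset => x _.
  pose n := (Num.truncn (\sum_(i < d) `|(x : 'rV[R]_d) ord0 i|)).+1.
  have xn i : `|(x : 'rV[R]_d) ord0 i| < n%:R.
    apply: le_lt_trans (truncnS_gt _).
    by rewrite (bigD1 i)//= lerDl sumr_ge0.
  exists n => // i; rewrite !mxE; have := xn i; rewrite ltr_norml => /andP[-> /ltW ->].
  by [].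
move=> n; split; first exact: measurable_obox.
by rewrite lamL ?ltry// => i; rewrite !mxE; apply: (@le_trans _ _ 0); rewrite ?oppr_le0.
Qed.

Lemma lebesgue_cube (R : realType) (d : nat)
  (lam : {measure set (RdB R d) -> \bar R})
  (e : R) (x : 'rV[R]_d) : is_lebesgue lam -> 0 <= e ->
  lam (obox (x - const_mx e) x) = (e ^+ d)%:E.
Proof.
move=> lamL e0; rewrite lamL; last by move=> i; rewrite !mxE gerBl.
under eq_bigr do rewrite !mxE opprB addrCA subrr addr0.
by rewrite prodr_const card_ord.
Qed.

Lemma measurable_point (R : realType) (d : nat) (x : RdB R d) : measurable [set x].
Proof.
have ms := @measurable_sqdistr R d x.
rewrite (_ : [set x] = (fun y => sqdist x y) @^-1` [set 0]).
  by rewrite -[_ @^-1` _]setTI; exact: ms.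
apply/seteqP; split=> y /=; first by move=> ->; apply/eqP; rewrite sqdist_eq0.
by move/eqP; rewrite sqdist_eq0 => /eqP.
Qed.

Lemma lebesgue_point (R : realType) (d : nat)
  (lam : {measure set (RdB R d) -> \bar R})
  (x : RdB R d) : is_lebesgue lam -> (0 < d)%N -> lam [set x] = 0%E.
Proof.
move=> lamL d0; apply/eqP; rewrite eq_le measure_ge0 andbT.
apply/lee_addgt0Pr => e e0; rewrite add0e.
(* A side [s <= 1] gives [s^d <= s <= e]; this is where [d > 0] enters. *)
pose s := Num.min 1 e.
have s0 : 0 < s by rewrite lt_min ltr01.
apply: (@le_trans _ _ (lam (obox ((x : 'rV[R]_d) - const_mx s) x))).
  apply: le_measure; rewrite ?inE; [exact: measurable_point|exact: measurable_obox|].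
  by move=> _ -> i; rewrite !mxE ltrBlDr ltrDl s0 lexx.
rewrite lebesgue_cube ?(ltW s0)// lee_fin.
apply: (@le_trans _ _ s); last by rewrite /s ge_min lexx orbT.
rewrite -{2}(expr1 s) ler_wiXn2l// ?(ltW s0)// /s ge_min lexx//.
Qed.

Lemma lebesgue_eball0_gt0 (R : realType) (d : nat)
  (lam : {measure set (RdB R d) -> \bar R})
  (r : R) : is_lebesgue lam -> 0 < r -> (0 < lam (eball0 r))%E.
Proof.
(* A cube of side [c] with a corner at the origin fits into the ball, since
   [d c^2 = d r^2 / (d + 1)^2 < r^2], also for [d = 0]. *)
move=> lamL r0; pose c := r / d.+1%:R.
have d1 : 0 < d.+1%:R :> R by rewrite ltr0n.
have c0 : 0 < c by rewrite divr_gt0.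
apply: (@lt_le_trans _ _ (lam (obox (0 - const_mx c) (0 : 'rV[R]_d)))).
  by rewrite lebesgue_cube ?(ltW c0)// lte_fin exprn_gt0.
apply: le_measure; rewrite ?inE; [exact: measurable_obox|exact: measurable_eball0|].
move=> x xc; rewrite /eball0 /= enorm_lt ?(ltW r0)//.
apply: (@le_lt_trans _ _ (\sum_(i < d) c ^+ 2)).
  apply: ler_sum => i _; have := xc i; rewrite !mxE oppr0 addr0 sub0r => /andP[xl xu].
  by rewrite -sqrrN lerXn2r ?nnegrE ?oppr_ge0 ?(ltW c0)// lerNl ltW.
rewrite sumr_const card_ord -mulr_natr /c expr_div_n mulrAC ltr_pdivrMr ?exprn_gt0//.
rewrite ltr_pM2l ?exprn_gt0// -natrX ltr_nat.
by rewrite (leq_trans (ltnSn d))// leq_pmulr.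
Qed.

(** A zero integral would force [w = 0] almost everywhere on [D], hence [D] null. *)
Lemma integral_pos_gt0 d (T : measurableType d) (R : realType)
  (mu : {measure set T -> \bar R}) (D : set T) (w : T -> R) :
  measurable D -> measurable_fun setT w -> (forall x, 0 < w x) ->
  (0 < mu D)%E -> (0 < \int[mu]_(x in D) (w x)%:E)%E.
Proof.
move=> mD mw w0 muD.
rewrite lt_neqAle integral_ge0 ?andbT; last by move=> x _; rewrite lee_fin ltW.
apply/eqP => I0.
have mwD : measurable_fun D (fun x => (w x)%:E).
  by apply/measurable_EFinP; exact: measurable_funTS.
have : (\int[mu]_(x in D) `|(w x)%:E| = 0)%E.
  by rewrite I0; apply: eq_integral => x _; rewrite gee0_abs// lee_fin ltW.
move/(ae_eq_integral_abs mu mD mwD) => [N [mN N0 DN]].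
have : (mu D <= mu N)%E.
  apply: le_measure; rewrite ?inE// => x Dx; apply: DN => /= /(_ Dx) [] wx.
  by have := w0 x; rewrite wx ltxx.
by rewrite N0 leNgt muD.
Qed.

(** * From the jump kernel on R^d to the abstract inequality *)

Unset Implicit Arguments.

Theorem theorem3p4 (R : realType) (d : nat)
  (lam : {measure set (RdB R d) -> \bar R})
  (V : 'rV[R]_d -> R) (j : 'rV[R]_d -> 'rV[R]_d -> R) :
  (0 < d)%N ->
  is_lebesgue lam ->
  (* V: locally bounded, measurable, int e^{-V} < oo *)
  measurable_fun (setT : set (RdB R d)) (V : RdB R d -> R) ->
  locbdd V ->
  (ZV lam V < +oo)%E ->
  (* j: nonnegative, symmetric, measurable off the diagonal *)
  (forall x y, x <> y -> 0 <= j x y) ->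
  (forall x y, x <> y -> j x y = j y x) ->
  measurable_fun ([set p | p.1 <> p.2] : set (RdB R d * RdB R d))
     (fun p : RdB R d * RdB R d => j p.1 p.2) ->
  (* I_1 in L^1(mu_V), I_1 and I_2 locally bounded *)
  measurable_fun (setT : set (RdB R d)) (I1 lam V j : RdB R d -> \bar R) ->
  (intV lam V setT (I1 lam V j) < +oo)%E ->
  locbdde (I1 lam V j) ->
  locbdde (I2 lam V j) ->
  forall (phi h : 'rV[R]_d -> R) (b r0 : R),
  in_Chat lam V j phi ->
  (forall x, 1 <= phi x) ->
  smooth h ->
  (forall x, 0 < h x) ->
  0 < b -> 0 < r0 ->
  (forall x, (Lhat lam V j phi x <= (- h x + b * \1_(eball0 r0) x)%:E)%E) ->
  (intV lam V setT (fun x => (phi x / h x)%:E) < +oo)%E ->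
  (forall r : R, 1 < r -> (kappa lam V j r < +oo)%E) ->
  exists C1 : R, 0 < C1 /\
    forall f : 'rV[R]_d -> R, Cb_smooth f ->
      intV lam V setT (fun x => (f x)%:E) = 0%E ->
      (intV lam V setT (fun x => (f x ^+ 2 * h x / phi x)%:E)
        <= C1%:E * Dform lam V j f)%E.
Proof.
move=> d0 lamL mV _ Zfin j0 jsym mj mI1 I1int I1loc _ phi h b r0 [phis philoc] phi1 hs h0
  b0 r00 lyap tailfin kapfin.
have [m mE] := sigma_finite_measure_exists (lebesgue_sigma_finite lamL).
set w := densV lam V.
have lam0 (r : R) : 0 < r -> (0 < lam (eball0 r))%E by exact: lebesgue_eball0_gt0.
have mexpV : measurable_fun (setT : set (RdB R d)) (fun x : RdB R d => expR (- V x)).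
  by apply: measurableT_comp => //; exact: measurable_funN.
have Z0 : (0 < ZV lam V)%E.
  apply: integral_pos_gt0 => // [x|]; first exact: expR_gt0.
  apply: lt_le_trans (lam0 1 ltr01) _.
  by apply: le_measure; rewrite ?inE//; exact: measurable_eball0.
have Zf : ZV lam V \is a fin_num by rewrite ge0_fin_numE// ltW.
have z0 : 0 < fine (ZV lam V) by rewrite fine_gt0// Z0.
have w0 x : 0 < w x by rewrite divr_gt0// expR_gt0.
have w0' x : 0 <= w x by exact: ltW.
have mw : measurable_fun (setT : set (RdB R d)) (w : RdB R d -> R).
  by apply: measurable_funM.
have wW : (\int[m]_x (w x)%:E = 1%:E)%E.
  rewrite mE; under eq_integral do rewrite /w /densV mulrC EFinM.
  rewrite ge0_integralZl_EFin ?invr_ge0 ?(ltW z0)//; last exact/measurable_EFinP.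
  have -> : (\int[lam]_x (expR (- V x))%:E)%E = (fine (ZV lam V))%:E by rewrite fineK.
  by rewrite -EFinM mulVf// gt_eqF.
(* [j] is arbitrary on the diagonal, even negative or nonmeasurable; its value
   there is reset to [1]. *)
pose j' (x y : RdB R d) : R := if sqdist x y == 0 then 1 else j x y.
pose K (x y : RdB R d) : R := if 1 < sqdist x y then j' x y else 0.
have ms := @measurable_sqdist R d.
have mj' : measurable_fun setT (fun z : RdB R d * RdB R d => j' z.1 z.2).
  apply: measurable_fun_if => //.
  - by apply: measurable_fun_eqr.
  - rewrite setTI (_ : _ @^-1` _ = [set p | p.1 <> p.2])//.
    apply/seteqP; split=> -[x y] /=; rewrite sqdist_eq0; first by move/negbT/eqP.
    by move/eqP/negbTE.
have mK : measurable_fun setT (fun z : RdB R d * RdB R d => K z.1 z.2).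
  by apply: measurable_fun_ifT => //; exact: measurable_fun_ltr.
have jj' x y : x <> y -> j' x y = j x y.
  by move=> /eqP/negbTE xy; rewrite /j' sqdist_eq0 xy.
have j'0 x y : 0 <= j' x y.
  by rewrite /j'; case: ifPn => //; rewrite sqdist_eq0 => /eqP /j0.
have j'sym x y : j' x y = j' y x.
  rewrite /j' sqdistC; case: ifPn => //; rewrite sqdist_eq0 => /eqP yx.
  by apply: jsym => xy; apply: yx.
have K0 x y : 0 <= K x y by rewrite /K; case: ifP.
have Kj x y : K x y <= j' x y by rewrite /K; case: ifP.
have Ksym x y : K x y = K y x by rewrite /K sqdistC j'sym.
have msx (x : RdB R d) := @measurable_sqdistr R d x.
have mjx (x : RdB R d) : measurable_fun setT (j' x).
  exact: (measurableT_comp mj' (pair1_measurable x)).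
have mKx (x : RdB R d) : measurable_fun setT (K x).
  exact: (measurableT_comp mK (pair1_measurable x)).
have mKw (x : RdB R d) : measurable_fun setT (fun y => K x y * w y).
  exact: measurable_funM.
have Kw0 x y : 0 <= K x y * w y by exact: mulr_ge0.
pose J x := (\int[m]_y (K x y * w y)%:E)%E.
have J0 x : (0 <= J x)%E by apply: integral_ge0 => y _; rewrite lee_fin.
have mJ : measurable_fun setT J.
  apply: (@measurable_fun_fubini_tonelli_F _ _ _ _ _ m
      (fun z => (K z.1 z.2 * w z.2)%:E)) => /=.
    apply/measurable_EFinP; apply: measurable_funM => //.
    by apply: (measurableT_comp mw); exact: measurable_snd.
  by move=> z; rewrite lee_fin.
(* Where [K] is nonzero the weight in [I1] is 1; on the diagonal that weight is 0, so the reset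
   value of [j] does not matter. *)
have JI1 x : (J x <= I1 lam V j x)%E.
  rewrite /J mE /I1 /intV; apply: ge0_le_integral => //.
  - by move=> y _; rewrite lee_fin.
  - exact/measurable_EFinP.
  - rewrite (_ : (fun y => _) =
      (fun y : RdB R d => (Num.min 1 (sqdist x y) * j' x y * w y)%:E)).
      apply/measurable_EFinP; apply: measurable_funM => //.
      by apply: measurable_funM => //; exact: measurable_minr.
    apply/funext => y; rewrite -EFinM enorm_sqr /j' ; congr (_ * _)%:E.
    case: ifPn => // /eqP ->.
    by rewrite min_r// !mul0r.
  - move=> y _; rewrite -EFinM lee_fin enorm_sqr; apply: ler_wpM2r => //.
    rewrite /K; case: ifPn => [d1|_].
      rewrite min_l ?mul1r ?(ltW d1)// /j'; case: ifPn => // /eqP E.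
      by move: d1; rewrite E ltNge ler01.
    have [xy|xy] := pselect (x = y).
      by rewrite xy (eqP (_ : sqdist y y == 0)) ?sqdist_eq0// min_r// mul0r.
    by rewrite mulr_ge0 ?j0// le_min ler01 sqdist_ge0.
have locfin (g : 'rV[R]_d -> \bar R) x : locbdde g -> (0 <= g x)%E -> (g x < +oo)%E.
  move=> /(_ x) [e [e0 [M gM]]] g0; rewrite -(gee0_abs g0).
  apply: (le_lt_trans (gM x _)) (ltry _); rewrite subrr enorm_lt ?(ltW e0)//.
  by rewrite (eqP (_ : sqdist 0 0 == 0)) ?sqdist_eq0// exprn_gt0.
have Jfin x : (J x < +oo)%E.
  by apply: (le_lt_trans (JI1 x)); apply: locfin => //; exact: le_trans (JI1 x).
have cphi : continuous phi by have [] := phis [::].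
have ch : continuous h by have [] := hs [::].
have mphi := continuous_measurable_RdB cphi.
have mh := continuous_measurable_RdB ch.
have phi0 x : 0 < phi x by rewrite (lt_le_trans ltr01).
have far (x : RdB R d) (g : RdB R d -> R) :
    (\int[m]_(y in [set y | (1 < enorm ((x : 'rV[R]_d) - y))%R]) (g y * j x y * w y)%:E
     = \int[m]_y (g y * (K x y * w y))%:E)%E.
  rewrite integral_mkcond; apply: eq_integral => y _.
  rewrite patchE /K; case: ifPn.
    move=> /set_mem /=; rewrite enorm_gt1 => d1; rewrite d1 mulrA /j'; case: ifPn => // /eqP E.
    by move: d1; rewrite E ltNge ler01.
  move=> /negP yn; case: ifPn => [d1|_]; last by rewrite mul0r mulr0.
  by exfalso; apply: yn; apply/mem_set; rewrite /= enorm_gt1.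
pose P x := (\int[m]_y (phi y * (K x y * w y))%:E)%E.
have P0 x : (0 <= P x)%E.
  by apply: integral_ge0 => y _; rewrite lee_fin mulr_ge0// ltW.
have mphiK (x : RdB R d) : measurable_fun setT (fun y : RdB R d => phi y * (K x y * w y)).
  exact: measurable_funM.
have Pfin x : (P x < +oo)%E.
  have E : intV lam V [set y | (1 < enorm (x - y))%R]
      (fun y => (`|phi y| * j x y)%:E) = P x.
    rewrite /P -far /intV mE; apply: eq_integral => y _.
    by rewrite -EFinM gtr0_norm.
  rewrite -E; apply: (@locfin (fun x => intV lam V [set y | (1 < enorm (x - y))%R]
      (fun y => (`|phi y| * j x y)%:E))) => //.
  by rewrite E.
have iP (x : RdB R d) : m.-integrable setT (EFin \o (fun y : RdB R d => phi y * (K x y * w y))).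
  apply/integrableP; split; first exact/measurable_EFinP.
  under eq_integral do rewrite /= (ger0_norm (mulr_ge0 (ltW (phi0 _)) (Kw0 _ _))).
  exact: Pfin.
have iJ (x : RdB R d) : m.-integrable setT (EFin \o (fun y => K x y * w y)).
  apply/integrableP; split; first exact/measurable_EFinP.
  under eq_integral do rewrite /= (ger0_norm (Kw0 _ _)).
  exact: Jfin.
(* [P x] is finite by membership in the class of [phi], and [J x] by local boundedness of [I1]; so
   [Lhat] splits into a difference, whose negative part can change sides. *)
have lyap' x : ((h x)%:E + P x <= (phi x)%:E * J x + (b * \1_(eball0 r0) x)%:E)%E.
  have := lyap x.
  have -> : (Lhat lam V j phi x = P x - (phi x)%:E * J x)%E.
    rewrite /Lhat /intV -mE.
    under eq_integral do rewrite -EFinM.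
    rewrite far.
    under eq_integral do rewrite mulrBl EFinB (EFinM (phi x)).
    rewrite integralB//; [|exact: iP|by apply: integrableZl => //; exact: iJ].
    by rewrite (integralZl measurableT (iJ x)).
  have Pf : P x \is a fin_num by rewrite (ge0_fin_numE (P0 x)); exact: Pfin.
  have Jf : J x \is a fin_num by rewrite (ge0_fin_numE (J0 x)); exact: Jfin.
  rewrite -(fineK Pf) -(fineK Jf).
  rewrite -EFinM -EFinB -!EFinD !lee_fin; lra.
(* The [2] keeps every radius above 1, where [kappa] is assumed finite, and the [r0] makes every
   ball contain [eball0 r0]. *)
pose B n : set (RdB R d) := eball0 (r0 + 2 + n%:R).
have BT : \bigcup_n B n = setT.
  rewrite -subTset => x _; exists (Num.truncn (enorm x)).+1 => //.
  rewrite /B /eball0 /=; apply: lt_le_trans (truncnS_gt _) _.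
  by rewrite lerDr; lra.
have kap n : exists2 S : R, 0 < S & forall x, B n x ->
    (\int[m]_(y in B n) ((j' x y)%:E^-1 * (w y)%:E) <= S%:E)%E.
  have r1 : 1 < r0 + 2 + n%:R by have := ler0n R n; lra.
  have := kapfin _ r1; rewrite /kappa.
  set I := muV _ _ _; set sup := ereal_sup _.
  have mB : measurable (B n) by exact: measurable_eball0.
  have IE : I = (\int[m]_(x in B n) (w x)%:E)%E.
    by rewrite mE; apply: eq_integral => x _; rewrite mul1e.
  have Ip : (0 < I)%E.
    by rewrite IE mE; apply: integral_pos_gt0 => //; apply: lam0; lra.
  have If : I \is a fin_num.
    rewrite ge0_fin_numE ?(ltW Ip)// IE; apply: (@le_lt_trans _ _ (\int[m]_x (w x)%:E)%E).
      apply: ge0_subset_integral => //; first exact/measurable_EFinP.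
      by move=> x _; rewrite lee_fin.
    by rewrite wW ltry.
  have i0 : 0 < fine I by rewrite fine_gt0// Ip ltey_eq If.
  (* For fixed [x], [j] and [j'] differ at most at the point [x], which is null; [j] itself is
     measurable in [y] because the value at that one point is a constant. *)
  have supE x : B n x -> (\int[m]_(y in B n) ((j' x y)%:E^-1 * (w y)%:E) <= sup)%E.
    move=> Bx; apply: ereal_sup_ubound; exists x => //.
    rewrite /intV -mE; have mp := @measurable_point R d x.
    have j'inv : measurable_fun setT (fun y => (j' x y)%:E^-1)%E.
      exact: emeasurable_fun_posinv.
    apply: ae_eq_integral => //.
    - apply: emeasurable_funM; last by apply/measurable_EFinP; exact: measurable_funTS.
      rewrite (_ : (fun y => _) = (fun y : RdB R d =>
          if sqdist x y == 0%R then (j x x)%:E^-1 else (j' x y)%:E^-1)%E).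
        by apply: measurable_funTS; apply: measurable_fun_ifT => //; exact: measurable_fun_eqr.
      apply/funext => y; rewrite /j'; case: ifPn => [|/negbTE -> //].
      by rewrite sqdist_eq0 => /eqP ->.
    - apply: emeasurable_funM; last by apply/measurable_EFinP; exact: measurable_funTS.
      exact: measurable_funTS.
    - have mx0 : (m : set (RdB R d) -> \bar R) [set (x : RdB R d)] = 0%E.
        by rewrite mE lebesgue_point.
      exists [set (x : RdB R d)]; split => //.
      move=> y /= H; apply: contrapT => yx; apply: H => _.
      by rewrite jj'// => xy; apply: yx.
  move=> ksup.
  have supfin : (sup < +oo)%E.
    (* The prefactor of [kappa] is positive, so an infinite supremum would make [kappa] infinite. *)
    rewrite ltey; apply/eqP => E; move: ksup.
    by rewrite E gt0_muley ?ltxx// lte_fin invr_gt0 exprn_gt0.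
  exists (`|fine sup| + 1); first by rewrite ltr_wpDl.
  move=> x Bx; apply: (le_trans (supE x Bx)).
  case: sup supfin {supE ksup} => [s||] // _; last exact: leNye.
  by rewrite lee_fin /= (le_trans (ler_norm s))// lerDl.
have Kfin : (\int[m]_x \int[m]_y (K x y * w y * w x)%:E < +oo)%E.
  apply: le_lt_trans I1int; rewrite /intV -mE.
  rewrite (_ : (fun x => _) = (fun x => J x * (w x)%:E)%E); last first.
    apply/funext => x; rewrite muleC -ge0_integralZl_EFin//; last 2 first.
    - by move=> y _; rewrite lee_fin.
    - exact/measurable_EFinP.
    by apply: eq_integral => y _; rewrite -EFinM mulrC.
  have mwE : measurable_fun setT (fun x : RdB R d => (w x)%:E).
    exact/measurable_EFinP.
  apply: ge0_le_integral => //.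
  - by move=> x _; rewrite mule_ge0 ?lee_fin.
  - exact: emeasurable_funM.
  - exact: emeasurable_funM.
  - by move=> x _; apply: lee_wpmul2r => //; rewrite lee_fin.
have [] := @lyapunov_weighted_poincare _ _ _ m j' K w phi h (eball0 r0) B 1 b
  mj' mK K0 Kj Ksym mw w0' wW ltr01 mphi phi1 mh h0 (@measurable_eball0 R d r0) b0
  Kfin lyap' _ _ _ BT _ kap.
- rewrite mE; apply: le_lt_trans tailfin.
  by rewrite le_eqVlt; apply/orP; left; apply/eqP/eq_integral => x _; rewrite EFinM.
- by move=> n; exact: measurable_eball0.
- move=> n k nk x; rewrite /B /eball0 /= => /lt_le_trans; apply.
  by rewrite lerD2l ler_nat.
- move=> n x; rewrite /B /eball0 /= => /lt_le_trans; apply.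
  by have := ler0n R n; lra.
move=> C C0 HC; exists C; split => // f [fs fb] f0.
have cf : continuous f by have [] := fs [::].
have [M fM] := fb [::].
have := HC f M (continuous_measurable_RdB cf) fM.
have -> : (\int[m]_x (f x * w x)%:E = 0)%E.
  by rewrite mE -f0; apply: eq_integral => x _; rewrite EFinM.
move=> /(_ erefl).
have -> : (\int[m]_x (f x ^+ 2 * h x / phi x * w x)%:E)%E =
    intV lam V setT (fun x => (f x ^+ 2 * h x / phi x)%:E).
  by rewrite /intV -mE; apply: eq_integral => x _; rewrite EFinM.
congr (_ <= _ * (_ * _))%E.
rewrite /intV -mE; apply: eq_integral => x _.
have mfE : measurable_fun setT (fun y : RdB R d => (f y - f x) ^+ 2 * j' x y * w y).
  apply: measurable_funM => //; apply: measurable_funM => //.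
  apply: measurable_funX; apply: measurable_funB => //.
  exact: continuous_measurable_RdB.
rewrite muleC.
have -> : (\int[m]_y (((f y - f x) ^+ 2 * j x y)%:E * (densV lam V y)%:E) =
    \int[m]_y ((f y - f x) ^+ 2 * j' x y * w y)%:E)%E.
  apply: eq_integral => y _; rewrite -EFinM; congr (_ * _)%:E.
  (* On the diagonal the squared increment vanishes, so the energy does not see the change from [j]
     to [j']. *)
  have [->|xy] := pselect (x = y); first by rewrite subrr expr0n !mul0r.
  by rewrite jj'.
rewrite -ge0_integralZl_EFin//.
- by apply: eq_integral => y _; rewrite -EFinM mulrC.
- move=> y _; rewrite lee_fin.
  exact: mulr_ge0 (mulr_ge0 (sqr_ge0 _) (j'0 _ _)) (w0' _).
- exact/measurable_EFinP.
Qed.
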